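(* Let $m$ be a positive integer, $\mathbb{Z}_m=\{0,1,\dots,m-1\}$, and let $\Omega=\mathbb{Z}_m^{\mathbb{Z}}$ be the space of doubly infinite sequences $x=(x_n)_{n=-\infty}^{\infty}$, $x_n\in\mathbb{Z}_m$, equipped with its product $\sigma$-algebra $\mathcal{B}$ and the uniform Bernoulli measure $\mu$. Let $\ell\le r$ be integers and let $f_\infty:\Omega\to\Omega$ be the additive cellular automaton given by $$f_\infty(x)=(y_n)_{n=-\infty}^{\infty},\qquad y_n=\sum_{i=\ell}^{r}x_{n+i}\pmod m\qquad\text{for all }x\in\Omega .$$ Let $\sigma$ be the shift on $\Omega$, and for $(p,n)\in\mathbb{Z}^+\times\mathbb{Z}^+$ put $T_{p,n}=\sigma^{p}f_\infty^{\,n}$. Then the action $(p,n)\mapsto T_{p,n}$ on $(\Omega,\mathcal{B},\mu)$ is ergodic, strongly mixing and weakly mixing.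
   Context: The shift $\sigma:\Omega\to\Omega$ is $(\sigma x)_n=x_{n+1}$. The measure $\mu$ is the product measure on $\mathbb{Z}_m^{\mathbb{Z}}$ whose one-coordinate marginals satisfy $\mu(\{x:x_0=i\})=\frac1m$ for each $i\in\mathbb{Z}_m$. For $i,j\ge 0$, $T_{i,j}=\sigma^i f_\infty^{\,j}$ (so $T_{0,0}=\mathrm{id}$), and $T_{(-i,-j)}(A)$ denotes the preimage $T_{i,j}^{-1}(A)=f_\infty^{-j}(\sigma^{-i}(A))$ (the map $f_\infty$ need not be invertible). The mixing properties of the two-parameter action are understood as follows, where $D=D_{p,n}=([0,p-1]\times[0,n-1])\cap\mathbb{Z}^2$ and $\lim_{p,n\to\infty}$ is the limit as both $p$ and $n$ tend to infinity: - Ergodic: for all $A,B\in\mathcal{B}$, $\lim_{p,n\to\infty}\frac{1}{pn}\sum_{(i,j)\in D}\mu\big(B\cap T_{(-i,-j)}(A)\big)=\mu(A)\mu(B)$. - Weakly mixing: for all $A,B\in\mathcal{B}$, $\lim_{p,n\to\infty}\frac{1}{pn}\sum_{(i,j)\in D}\big|\mu\big(B\cap T_{(-i,-j)}(A)\big)-\mu(A)\mu(B)\big|=0$. - Strongly mixing: for all $A,B\in\mathcal{B}$, $\lim_{p,n\to\infty}\mu\big(T_{(-p,-n)}(A)\cap B\big)=\mu(A)\mu(B)$.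
   Formalization: Strong mixing is claimed except when m ≥ 2 and ℓ = r < 0, where it is false: then f_∞ = σ^ℓ, so T_{-ℓn,n} = id for all n, and A = B = {x_0 = 0} gives 1/m instead of 1/m². Ergodicity and weak mixing are stated for all ℓ ≤ r. *)

(* Defs.v *)
From HB Require Import structures.
From mathcomp Require Import all_boot all_order all_algebra.
From mathcomp Require Import all_classical all_reals all_analysis.
Set Implicit Arguments.
Unset Strict Implicit.
Unset Printing Implicit Defensive.
Import Order.TTheory GRing.Theory Num.Theory.
Import numFieldNormedType.Exports.
Local Open Scope classical_set_scope.
Local Open Scope ring_scope.

(* The alphabet Z_m is 'I_m with explicit reduction mod m, because 'Z_1 would be
   Z/2. The positivity proof is only needed to inhabit the space. *)
Definition config (m : nat) (hm : (0 < m)%N) : Type := int -> 'I_m.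

HB.instance Definition _ m (hm : (0 < m)%N) :=
  Choice.copy (config hm) (int -> 'I_m).
HB.instance Definition _ m (hm : (0 < m)%N) :=
  isPointed.Build (config hm) (fun=> Ordinal hm).

Definition coordinate_sets m (hm : (0 < m)%N) : set (set (config hm)) :=
  [set A | exists k : int, exists E : set 'I_m, A = [set x | E (x k)]].

(* Z_m^Z with the product of the discrete sigma-algebras. *)
Definition Omega m (hm : (0 < m)%N) : measurableType _ :=
  g_sigma_algebraType (@coordinate_sets m hm).

(* These two conditions determine mu uniquely: finite-dimensional boxes form a
   pi-system that generates the product sigma-algebra. *)
Definition uniform_bernoulli (R : realType) m (hm : (0 < m)%N)
    (mu : probability (Omega hm) R) : Prop :=
  (forall (s : seq int) (E : int -> set 'I_m), uniq s ->
     mu [set x : Omega hm | forall k, k \in s -> E k (x k)] =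
     (\prod_(k <- s) mu [set x : Omega hm | E k (x k)])%E) /\
  (forall (k : int) (i : 'I_m),
     mu [set x : Omega hm | x k = i] = ((m%:R : R)^-1)%:E).

Definition left_shift m (hm : (0 < m)%N) (x : Omega hm) : Omega hm :=
  fun n => x (n + 1).

(* For l <= r the index l + j, with j < `|r - l| + 1, runs through l, ..., r. *)
Definition f_infty m (hm : (0 < m)%N) (l r : int) (x : Omega hm) : Omega hm :=
  fun n => Ordinal (ltn_pmod
    (\sum_(j < (absz (r - l)).+1) nat_of_ord (x (n + (l + j%:Z))%R))%N hm).

(* If l = r < 0 then f_infty is the l-th power of the shift, so this map is the
   identity whenever p = - l * n: for m > 1 the action is not strongly mixing. *)
Definition ca_action m (hm : (0 < m)%N) (l r : int) (p n : nat)
    (x : Omega hm) : Omega hm :=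
  iter p (@left_shift m hm) (iter n (f_infty l r) x).

Section Mixing.
Context (d : measure_display) (X : measurableType d) (R : realType).
Variables (mu : probability X R) (T : nat -> nat -> X -> X).

(* [filter_prod \oo \oo] is the limit as both indices tend to infinity,
   independently of each other. *)
Definition ergodic_action : Prop :=
  forall A B : set X, measurable A -> measurable B ->
  (fun pn : nat * nat => (pn.1%:R * pn.2%:R)^-1 *
     \sum_(i < pn.1) \sum_(j < pn.2) fine (mu (B `&` T i j @^-1` A)))
    @ filter_prod \oo \oo --> fine (mu A) * fine (mu B).

Definition weakly_mixing_action : Prop :=
  forall A B : set X, measurable A -> measurable B ->
  (fun pn : nat * nat => (pn.1%:R * pn.2%:R)^-1 *
     \sum_(i < pn.1) \sum_(j < pn.2)
       `|fine (mu (B `&` T i j @^-1` A)) - fine (mu A) * fine (mu B)|)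
    @ filter_prod \oo \oo --> (0 : R).

Definition strongly_mixing_action : Prop :=
  forall A B : set X, measurable A -> measurable B ->
  (fun pn : nat * nat => fine (mu (T pn.1 pn.2 @^-1` A `&` B)))
    @ filter_prod \oo \oo --> fine (mu A) * fine (mu B).

End Mixing.

(* Main.v *)
(* Let [a = p + n l] and [b = p + n r]. Coordinate [k] of [T_{p,n} x] is a linear
   form in [x_{k+a}, ..., x_{k+b}] whose two extreme coefficients are 1 (a unit,
   whatever [m] is). If [b > 2N] or [a < -2N], this triangular shape allows one to
   prescribe [T_{p,n} y] arbitrarily on [[-N, N]] with a [y] that vanishes on
   [[-N, N]]. Translation by such a [y] preserves [mu] and every set [B] depending
   on the coordinates in [[-N, N]], and it permutes transitively the patterns of
   [T_{p,n} x] on [[-N, N]]; hence [B] is exactly independent of [T_{p,n}^-1 A].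
   Approximating measurable sets by such cylinders gives asymptotic independence,
   uniformly over all [(p, n)] with [b > 2N] or [a < -2N]. The remaining [(p, n)]
   satisfy [|p + n l| <= 2N]: for each [n] they are at most [4N + 1], so they do
   not contribute to the averages, and they are absent for large [p] and [n]
   unless [l = r < 0]. *)
Require Import Defs.
From mathcomp Require Import all_boot all_order all_algebra.
From mathcomp Require Import all_classical all_reals all_analysis.
From mathcomp Require Import zify ring lra.
Set Implicit Arguments.
Unset Strict Implicit.
Unset Printing Implicit Defensive.
Import Order.TTheory GRing.Theory Num.Theory.
Import numFieldNormedType.Exports.
Local Open Scope classical_set_scope.
Local Open Scope ring_scope.

(** * Additivity and triangular shape of the action *)

Definition translate m (hm : (0 < m.+1)%N) (y x : Omega hm) : Omega hm :=
  fun k => x k + y k : 'I_m.+1.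

Definition spike m (hm : (0 < m.+1)%N) (j : int) (c : 'I_m.+1) : Omega hm :=
  fun k => if k == j then c else 0.

(** Reduction mod [m.+1] is additive, so reducing once at the end agrees with adding in the group
    ['I_m.+1]. All later algebra takes place in that group. *)
Lemma f_inftyE m (hm : (0 < m.+1)%N) (l r : int) (x : Omega hm) (k : int) :
  f_infty l r x k = \sum_(j < (absz (r - l)).+1) (x (k + (l + j%:Z)) : 'I_m.+1).
Proof.
apply: val_inj => /=.
apply: (big_ind2 (fun (a : nat) (b : 'I_m.+1) => (a %% m.+1)%N = b)).
- by rewrite mod0n.
- by move=> a b c d ab cd /=; rewrite -ab -cd modnDm.
- by move=> i _; rewrite modn_small.
Qed.

Lemma ca_action_translate m (hm : (0 < m.+1)%N) (l r : int) (p n : nat)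
    (y x : Omega hm) :
  ca_action l r p n (translate y x) =
  translate (ca_action l r p n y) (ca_action l r p n x).
Proof.
have fD u v : f_infty l r (translate u v) =
    translate (f_infty l r u) (f_infty l r v) :> Omega hm.
  by apply/funext => k; rewrite /translate !f_inftyE big_split.
rewrite /ca_action; have -> : iter n (f_infty l r) (translate y x) =
    translate (iter n (f_infty l r) y) (iter n (f_infty l r) x) :> Omega hm.
  by elim: n => //= n ->.
by elim: p => //= p ->.
Qed.

(* With [s = 1] this says that [y] vanishes to the left of [j], with [s = -1]
   that it vanishes to the right of [j]. *)
Definition starts_at m (hm : (0 < m.+1)%N) (s j : int) (c : 'I_m.+1)
    (y : Omega hm) : Prop :=
  (forall k, s * k < s * j -> y k = 0 :> 'I_m.+1) /\ y j = c.

(** The hypotheses make [e] the extreme offset in direction [s]: [r] for [s = 1], [l] for [s = -1].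
    Before [j - e] every summand reads a vanishing coordinate; at [j - e] only the offset [e]
    reaches [j], with coefficient 1. *)
Lemma starts_at_f_infty m (hm : (0 < m.+1)%N) (l r s e j : int) (c : 'I_m.+1)
    (y : Omega hm) :
  l <= e <= r -> (forall i, l <= i <= r -> i != e -> s * i < s * e) ->
  starts_at s j c y -> starts_at s (j - e) c (f_infty l r y).
Proof.
move=> /andP[le er] se [y0 yj]; split=> [k kj|].
  rewrite f_inftyE big1 // => -[i /= ir] _; apply: y0.
  have [->|ie] := eqVneq (l + i%:Z) e; first by nia.
  have : s * (l + i) < s * e by apply: se => //; lia.
  by nia.
have ei : (absz (e - l) < (absz (r - l)).+1)%N by lia.
rewrite f_inftyE (bigD1 (Ordinal ei)) //= big1 ?addr0.
  by rewrite -yj; congr y; lia.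
move=> -[i ir] /eqP ie; apply: y0.
have : s * (l + i) < s * e.
  apply: se; first by lia.
  by apply/eqP => lie; apply: ie; apply: val_inj => /=; lia.
by move=> /=; nia.
Qed.

Lemma starts_at_ca_action m (hm : (0 < m.+1)%N) (l r s e j : int)
    (c : 'I_m.+1) (p n : nat) (y : Omega hm) :
  l <= e <= r -> (forall i, l <= i <= r -> i != e -> s * i < s * e) ->
  starts_at s j c y ->
  starts_at s (j - (p%:Z + n%:Z * e)) c (ca_action l r p n y).
Proof.
move=> ler se yj; rewrite /ca_action.
have : starts_at s (j - n%:Z * e) c (iter n (f_infty l r) y).
  elim: n => [|n IH] /=; first by rewrite mul0r subr0.
  have -> : j - n.+1%:Z * e = j - n%:Z * e - e by lia.
  exact: starts_at_f_infty.
move: (iter n _ y) => z.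
elim: p => [|p IH] zj /=; first by rewrite add0r.
have [h0 h1] := IH zj; split=> [k kj|]; rewrite /left_shift.
  by apply: h0; nia.
by rewrite -h1; congr (iter p _ z _); lia.
Qed.

(** Triangular solving, one coordinate of the window at a time in direction [s]: a spike at
    [k0 + p + n e] adds its height to the image at [k0] and changes nothing before [k0]. The bound
    on [W] keeps every spike off [W]. *)
Lemma ca_action_interpolation m (hm : (0 < m.+1)%N) (l r s e : int) (p n N : nat)
    (W : set int) (v : Omega hm) :
  (s == 1) || (s == -1) -> l <= e <= r ->
  (forall i, l <= i <= r -> i != e -> s * i < s * e) ->
  (forall k, W k -> s * k < s * (p%:Z + n%:Z * e) - N%:Z) ->
  exists y : Omega hm, (forall k, W k -> y k = 0 :> 'I_m.+1) /\
    forall k, `|k| <= N%:Z -> ca_action l r p n y k = v k.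
Proof.
move=> s1 ler se Wlt.
suff H : forall q : nat, exists y : Omega hm,
    (forall k, W k -> y k = 0 :> 'I_m.+1) /\
    forall k, - N%:Z <= s * k -> s * k < - N%:Z + q%:Z ->
      ca_action l r p n y k = v k.
  have [y [y0 yv]] := H (N + N).+1; exists y; split=> // k kN.
  by apply: yv; case/orP: s1 => /eqP ->; lia.
elim=> [|q [y [y0 yv]]].
  by exists (fun=> 0); split=> // k; lia.
(* As [s * s = 1], this is the next coordinate in direction [s], the first one not yet adjusted; [c]
   below is its remaining defect. *)
pose k0 := s * (- N%:Z + q%:Z).
have sk0 : s * k0 = - N%:Z + q%:Z.
  by rewrite /k0; case/orP: s1 => /eqP ->; lia.
pose j := k0 + (p%:Z + n%:Z * e).
pose c : 'I_m.+1 := v k0 - ca_action l r p n y k0.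
have [|h0 h1] := @starts_at_ca_action m hm l r s e j c p n (spike hm j c) ler se.
  split; last by rewrite /spike eqxx.
  by move=> k kj; rewrite /spike; case: eqP kj => // ->; rewrite ltxx.
have jk0 : j - (p%:Z + n%:Z * e) = k0 by rewrite /j addrK.
rewrite jk0 in h0 h1.
exists (translate (spike hm j c) y); split=> [k Wk|k kN kq].
  rewrite /translate y0// add0r /spike; case: eqP => // kj.
  have := Wlt _ Wk; rewrite kj /j mulrDr sk0; lia.
rewrite ca_action_translate /translate.
have [skq|skq] := ltP (s * k) (- N%:Z + q%:Z).
  by rewrite yv// h0 ?addr0// sk0.
have -> : k = k0 by rewrite /k0; case/orP: s1 kq kN skq => /eqP ->; lia.
by rewrite h1 /c addrC subrK.
Qed.

(** * Counting with finitely many fibers of equal mass *)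

Section FiniteFibers.
Context (d : measure_display) (X : measurableType d) (R : realType).
Variables (mu : probability X R) (F : finType) (g : X -> F).
Hypothesis mg : forall w, measurable (g @^-1` [set w]).

Lemma measurable_preimage_finType (S : set F) : measurable (g @^-1` S).
Proof.
have -> : g @^-1` S = \bigcup_(w in S) g @^-1` [set w].
  by apply/seteqP; split=> [x Sx|x [w Sw gw]]; [exists (g x)|rewrite /= gw].
by apply: fin_bigcup_measurable => //; exact: finite_finset.
Qed.

(** Additivity over disjoint fibers gives [c] times the number of elements, both for [S] and for all
    of [F]; eliminating [c] between the two counts yields the proportion. *)
Lemma equidistributed_fibers (C : set X) (c : R) (S : set F) :
  measurable C -> (forall w, mu (C `&` g @^-1` [set w]) = c%:E) ->
  fine (mu (C `&` g @^-1` S)) * #|F|%:R =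
  #|[pred w | `[< S w >]]|%:R * fine (mu C).
Proof.
move=> mC cE.
have H (s : seq F) : uniq s ->
    mu (C `&` g @^-1` [set w | w \in s]) = ((size s)%:R * c)%:E.
  elim: s => [_|w s IH /= /andP[ws us]].
    rewrite mul0r (_ : _ `&` _ = set0) ?measure0//.
    by apply/seteqP; split=> // x [].
  have -> : C `&` g @^-1` [set z | z \in w :: s] =
      (C `&` g @^-1` [set w]) `|` (C `&` g @^-1` [set z | z \in s]).
    rewrite -setIUr; congr (_ `&` _); apply/seteqP; split=> x /=.
      by rewrite inE => /orP[/eqP ->|?]; [left|right].
    by case=> [->|xs]; rewrite inE ?eqxx// xs orbT.
  have mI U : measurable (C `&` g @^-1` U).
    by apply: measurableI => //; exact: measurable_preimage_finType.
  transitivity (mu (C `&` g @^-1` [set w]) +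
      mu (C `&` g @^-1` [set z | z \in s]))%E.
    apply: measureU; [exact: mI..|apply/seteqP; split=> // x].
    by move=> [[_ /= ->] [_ /=]]; rewrite (negbTE ws).
  by rewrite cE IH// -EFinD -natr1 mulrDl mul1r addrC.
have -> : C `&` g @^-1` S =
    C `&` g @^-1` [set w | w \in enum [pred w | `[< S w >]]].
  by congr (_ `&` _); apply/seteqP; split=> x /=; rewrite mem_enum inE.
have -> : mu C = mu (C `&` g @^-1` [set w | w \in enum F]).
  congr (mu _); apply/seteqP; split=> [x Cx|x []//].
  by split=> //=; rewrite mem_enum.
by rewrite !H ?enum_uniq//= -!cardE mulrAC mulrA.
Qed.

End FiniteFibers.

(** * Cylinder sets and the Bernoulli measure *)

Definition depends_on m (hm : (0 < m)%N) (W : set int) (A : set (Omega hm)) :=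
  forall x y : Omega hm, (forall k, W k -> x k = y k) -> A x -> A y.

Definition window (N : nat) : set int := [set k | `|k| <= N%:Z].

(** Restriction to the window is encoded in a finite type so that the counting of fibers applies to
    it. *)
Definition pattern m (hm : (0 < m)%N) (N : nat) (x : Omega hm) :
    {ffun 'I_(N.*2.+1) -> 'I_m} := [ffun i : 'I_(N.*2.+1) => x (i%:Z - N%:Z)].

Section Cylinders.
Context (m : nat) (hm : (0 < m)%N).

Lemma patternP (N : nat) (x y : Omega hm) :
  pattern N x = pattern N y <-> forall k, window N k -> x k = y k.
Proof.
rewrite /window; split=> [/ffunP xy k /= kN|xy].
  have kN' : (absz (k + N%:Z)%R < N.*2.+1)%N by lia.
  have := xy (Ordinal kN'); rewrite !ffunE /=.
  by have -> : (absz (k + N%:Z)%R)%:Z - N%:Z = k by lia.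
by apply/ffunP => -[i iN]; rewrite !ffunE; apply: xy => /=; lia.
Qed.

Lemma pattern_surj (N : nat) (w : {ffun 'I_(N.*2.+1) -> 'I_m}) :
  exists x : Omega hm, pattern N x = w.
Proof.
exists (fun k => w (inord (absz (k + N%:Z)))).
by apply/ffunP => i; rewrite ffunE subrK /= inord_val.
Qed.

Lemma measurable_coordinate (k : int) (E : set 'I_m) :
  measurable [set x : Omega hm | E (x k)].
Proof. by apply: sub_sigma_algebra; exists k, E. Qed.

Lemma measurable_pattern (N : nat) (w : {ffun 'I_(N.*2.+1) -> 'I_m}) :
  measurable ((@pattern m hm N) @^-1` [set w]).
Proof.
have -> : (@pattern m hm N) @^-1` [set w] =
    \bigcap_(i in [set: 'I_(N.*2.+1)]) [set x : Omega hm | x (i%:Z - N%:Z) = w i].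
  apply/seteqP; split=> [x /= <- i _ /=|x xw]; first by rewrite ffunE.
  by apply/ffunP => i; rewrite ffunE; exact: xw.
apply: fin_bigcap_measurable => [|i _]; first exact: finite_finset.
exact: (@measurable_coordinate (i%:Z - N%:Z) [set w i]).
Qed.

Lemma depends_onE (N : nat) (A : set (Omega hm)) :
  depends_on (window N) A -> A = pattern N @^-1` (pattern N @` A).
Proof.
move=> dA; apply/seteqP; split=> [x Ax|x [y Ay /patternP yx]]; first by exists x.
exact: dA Ay.
Qed.

Lemma measurable_depends_on (N : nat) (A : set (Omega hm)) :
  depends_on (window N) A -> measurable A.
Proof.
move=> /depends_onE ->; apply: measurable_preimage_finType.
exact: measurable_pattern.
Qed.

Lemma depends_onS (V W : set int) (A : set (Omega hm)) :
  V `<=` W -> depends_on V A -> depends_on W A.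
Proof. by move=> VW dA x y xy; apply: dA => k /VW; exact: xy. Qed.

Lemma depends_onC (W : set int) (A : set (Omega hm)) :
  depends_on W A -> depends_on W (~` A).
Proof. by move=> dA x y xy Ax Ay; apply/Ax/(dA y) => // k /xy. Qed.

Lemma depends_onI (W : set int) (A B : set (Omega hm)) :
  depends_on W A -> depends_on W B -> depends_on W (A `&` B).
Proof. by move=> dA dB x y xy [Ax Bx]; split; [exact: dA Ax|exact: dB Bx]. Qed.

Lemma windowS (M N : nat) : (M <= N)%N -> window M `<=` window N.
Proof. by move=> MN k; rewrite /window /=; lia. Qed.

Definition cylinder : set (set (Omega hm)) :=
  [set A | exists N, depends_on (window N) A].

Lemma cylinderI : setI_closed cylinder.
Proof.
move=> A B [M dA] [N dB]; exists (maxn M N); apply: depends_onI.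
  by apply: depends_onS dA; apply: windowS; rewrite leq_maxl.
by apply: depends_onS dB; apply: windowS; rewrite leq_maxr.
Qed.

Lemma cylinderC (A : set (Omega hm)) : cylinder A -> cylinder (~` A).
Proof. by move=> [N dA]; exists N; exact: depends_onC. Qed.

Lemma cylinder_setT : cylinder setT.
Proof. by exists 0%N. Qed.

Lemma cylinder_measurable : cylinder `<=` measurable.
Proof. by move=> A [N]; exact: measurable_depends_on. Qed.

Lemma cylinder_generates : measurable = <<s cylinder >>.
Proof.
apply/seteqP; split; last first.
  apply: smallest_sub; first exact: sigma_algebra_measurable.
  exact: cylinder_measurable.
apply: smallest_sub; first exact: smallest_sigma_algebra.
move=> _ [k [E ->]]; apply: sub_sigma_algebra; exists (absz k) => x y xy /=.
by rewrite xy// /window /=; lia.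
Qed.

Lemma pattern_atom_prob (R : realType) (mu : probability (Omega hm) R) (N : nat)
    (w : {ffun 'I_(N.*2.+1) -> 'I_m}) : uniform_bernoulli mu ->
  mu (pattern N @^-1` [set w]) = ((m%:R^-1 : R) ^+ N.*2.+1)%:E.
Proof.
move=> [muM mu1].
pose s := [seq i%:Z - N%:Z | i <- iota 0 N.*2.+1].
(* Quantifying over [i] gives a set for every integer [k] without inverting [i - N]; off the window
   the condition is vacuous. *)
pose E k := [set a | forall i : 'I_(N.*2.+1), k = i%:Z - N%:Z -> a = w i].
have us : uniq s by rewrite map_inj_uniq ?iota_uniq// => i j; lia.
have -> : pattern N @^-1` [set w] =
    [set x : Omega hm | forall k, k \in s -> E k (x k)].
  apply/seteqP; split=> x /=.
    by move=> xw k _ i ->; rewrite -xw ffunE.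
  move=> xE; apply/ffunP => i; rewrite ffunE; apply: (xE (i%:Z - N%:Z)) => //.
  by apply: (map_f (fun i : nat => i%:Z - N%:Z)); rewrite mem_iota add0n /=.
rewrite muM// (eq_big_seq (fun=> (m%:R^-1 : R)%:E)); last first.
  move=> k /mapP[i]; rewrite mem_iota add0n /= => iN ->.
  rewrite -(mu1 (i%:Z - N%:Z) (w (Ordinal iN))); congr (mu _).
  apply/seteqP; split=> x /=; first by move/(_ (Ordinal iN) erefl).
  move=> -> j ij; congr (w _); apply: val_inj => /=; lia.
by rewrite prodEFin big_const_seq count_predT size_map size_iota -Monoid.iteropE.
Qed.

(** Equality of the masses of all patterns suffices, whatever their value: they sum to 1, so the
    image measure counts patterns exactly as [mu] does. The two measures then agree on the pi-system
    of cylinders, hence everywhere. *)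
Lemma cylinder_invariance (R : realType) (mu : probability (Omega hm) R)
    (f : Omega hm -> Omega hm) :
  uniform_bernoulli mu -> measurable_fun setT f ->
  (forall N w w', mu (f @^-1` (pattern N @^-1` [set w])) =
                  mu (f @^-1` (pattern N @^-1` [set w']))) ->
  forall A, measurable A -> mu (f @^-1` A) = mu A.
Proof.
move=> mub mf fw.
pose nu := distribution mu (mfun_Sub (mem_set mf)).
suff H A : measurable A -> nu A = mu A by [].
apply: (@measure_unique _ _ _ cylinder (fun=> setT) cylinder_generates) => //.
- exact: cylinderI.
- by move=> _; exact: cylinder_setT.
- by rewrite bigcup_const//; exists 0%N.
- move=> {}A [N dA]; rewrite (depends_onE dA).
  have mp := @measurable_pattern N.
  pose x0 : Omega hm := fun=> Ordinal hm.
  have n0 : #|{ffun 'I_(N.*2.+1) -> 'I_m}|%:R != 0 :> R.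
    by rewrite pnatr_eq0 -lt0n; apply/card_gt0P; exists (pattern N x0).
  have e1 := @equidistributed_fibers _ _ _ nu _ _ mp setT
    (fine (nu (pattern N @^-1` [set pattern N x0])))
    (pattern N @` A) measurableT.
  have e2 := @equidistributed_fibers _ _ _ mu _ _ mp setT
    ((m%:R^-1 : R) ^+ N.*2.+1)
    (pattern N @` A) measurableT.
  have fin (rho : probability (Omega hm) R) B : measurable B -> rho B \is a fin_num.
    exact: fin_num_measure.
  have mA := measurable_preimage_finType mp (pattern N @` A).
  rewrite -[LHS]fineK; last exact: (fin nu _ mA).
  rewrite -[RHS]fineK; last exact: (fin mu _ mA).
  congr (_%:E); apply: (mulIf n0).
  rewrite !setTI in e1 e2.
  transitivity (#|[pred w | `[< (pattern N @` A) w >]]|%:R * fine (nu setT)).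
    apply: e1 => w; rewrite setTI fineK; first exact: fw.
    by apply: fin; exact: mp.
  apply/esym/e2 => w.
  by rewrite setTI; exact: pattern_atom_prob.
- by move=> _; apply: (le_lt_trans (probability_le1 nu measurableT)); rewrite ltry.
Qed.

End Cylinders.

(** * Approximation of measurable sets by a generating algebra *)

Section ProbabilityOfSets.
Context (d : measure_display) (X : measurableType d) (R : realType).
Variable mu : probability X R.

Lemma fine_probability_fin_num (A : set X) : measurable A -> mu A \is a fin_num.
Proof. exact: fin_num_measure. Qed.

Lemma fine_probability_ge0 (A : set X) : 0 <= fine (mu A).
Proof. by rewrite fine_ge0. Qed.

Lemma fine_probability_le1 (A : set X) : measurable A -> fine (mu A) <= 1.
Proof.
move=> mA; rewrite -lee_fin fineK ?probability_le1//.
exact: fine_probability_fin_num.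
Qed.

Lemma fine_probability_subU (A B C : set X) :
  measurable A -> measurable B -> measurable C -> A `<=` B `|` C ->
  fine (mu A) <= fine (mu B) + fine (mu C).
Proof.
move=> mA mB mC ABC.
have fin := fine_probability_fin_num.
rewrite -lee_fin EFinD !fineK ?fin//.
apply: (@le_trans _ _ (mu (B `|` C))); last exact: measureU2.
by apply: le_measure; rewrite ?inE//; exact: measurableU.
Qed.

Lemma measurable_setY (A B : set X) :
  measurable A -> measurable B -> measurable (A `+` B).
Proof. by move=> mA mB; apply: measurableU; exact: measurableD. Qed.

Lemma fine_probability_dist (A B : set X) :
  measurable A -> measurable B ->
  `|fine (mu A) - fine (mu B)| <= fine (mu (A `+` B)).
Proof.
move=> mA mB; have mAB := measurable_setY mA mB.
rewrite ler_distl; apply/andP; split.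
  rewrite lerBlDr; apply: fine_probability_subU => // x Bx.
  by have [Ax|nAx] := pselect (A x); [left|right; right].
rewrite addrC [leRHS]addrC; apply: fine_probability_subU => // x Ax.
by have [Bx|nBx] := pselect (B x); [left|right; left].
Qed.

(** Dynkin's argument: the approximable sets form a lambda-system containing the pi-system [G]. *)
Lemma algebra_approximation (G : set (set X)) :
  measurable = <<s G >> -> G setT -> setI_closed G ->
  (forall A, G A -> G (~` A)) ->
  forall A, measurable A -> forall eps : R, 0 < eps ->
  exists2 B, G B & fine (mu (A `+` B)) < eps.
Proof.
move=> mG GT GI GC.
have Gm B : G B -> measurable B by rewrite mG; exact: sub_sigma_algebra.
pose H := [set A : set X | measurable A /\ forall eps : R, 0 < eps ->
  exists2 B, G B & fine (mu (A `+` B)) < eps].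
suff GH : <<s G >> `<=` H by move=> A; rewrite mG => /GH[].
apply: lambda_system_subset => //; last first.
  move=> A GA; split=> [|e e0]; first exact: Gm.
  by exists A => //; rewrite setYK measure0.
split=> //.
- split=> // e e0; exists setT => //.
  by rewrite setYK measure0.
(* The symmetric difference of [A] minus [B] and [A'] minus [B'] lies in the union of those of
   [A, A'] and of [B, B']. *)
- move=> A B BA [mA aA] [mB aB]; split=> [|e e0]; first exact: measurableD.
  have e2 : 0 < e / 2 by rewrite divr_gt0.
  have [A' GA' A'e] := aA _ e2; have [B' GB' B'e] := aB _ e2.
  exists (A' `&` ~` B'); first by apply: GI => //; exact: GC.
  have mA' := Gm _ GA'; have mB' := Gm _ GB'.
  apply: (@le_lt_trans _ _ (fine (mu (A `+` A')) + fine (mu (B `+` B')))); last lra.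
  apply: fine_probability_subU; [|exact: measurable_setY..|].
    apply: measurable_setY; first exact: measurableD.
    by apply: measurableI => //; exact: measurableC.
  move=> x /=; rewrite /setY /setU /setD /setC /setI /=.
  by have [] := pselect (A x); have [] := pselect (B x);
     have [] := pselect (A' x); have [] := pselect (B' x); tauto.
(* By continuity from below some [F n] is within [e / 2] of the union; an approximation of that
   single set costs another [e / 2]. *)
- move=> F ndF FH.
  have mF i : measurable (F i) by case: (FH i).
  have mU : measurable (\bigcup_n F n) by exact: bigcupT_measurable.
  split=> // e e0.
  have e2 : 0 < e / 2 by rewrite divr_gt0.
  have : (mu \o F) n @[n --> \oo] --> (fine (mu (\bigcup_n F n)))%:E.
    rewrite fineK; first exact: nondecreasing_cvg_mu.
    exact: fine_probability_fin_num.
  move=> /fine_cvgP[_ /cvgrPdist_lt] /(_ _ e2)[n _ /(_ n (leqnn n))] /= Fn.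
  have [B GB Be] := (FH n).2 _ e2; exists B => //; have mB := Gm _ GB.
  have FnU : F n `<=` \bigcup_n F n by exact: bigcup_sup.
  have : fine (mu ((\bigcup_n F n) `\` F n)) < e / 2.
    apply: le_lt_trans Fn; rewrite measureD ?(setIidr FnU)//.
      by rewrite fineB ?ler_norm// fine_probability_fin_num.
    by rewrite -ge0_fin_numE// fine_probability_fin_num.
  move=> De; apply: (@le_lt_trans _ _
    (fine (mu ((\bigcup_n F n) `\` F n)) + fine (mu (F n `+` B)))); last lra.
  apply: fine_probability_subU; [exact: measurable_setY|exact: measurableD|
    exact: measurable_setY|].
  move=> x; rewrite /setY /setU /setD /=.
  by have [] := pselect (F n x); have := FnU x; tauto.
Qed.

End ProbabilityOfSets.

(** * Measurability of the maps and invariance under translations *)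

Lemma measurable_fun_Omega m (hm : (0 < m)%N) (f : Omega hm -> Omega hm) :
  (forall (k : int) (E : set 'I_m), measurable [set x | E (f x k)]) ->
  measurable_fun setT f.
Proof.
move=> fE; apply: (@measurability _ _ (Omega hm) (Omega hm) setT f
  (@coordinate_sets m hm : set (set (Omega hm)))) => //.
by move=> _ [_ [k [E ->]] <-]; rewrite setTI; exact: fE.
Qed.

Lemma measurable_ca_action m (hm : (0 < m)%N) (l r : int) (p n : nat) :
  measurable_fun setT (ca_action l r p n : Omega hm -> Omega hm).
Proof.
have mf : measurable_fun setT (f_infty l r : Omega hm -> Omega hm).
  apply: measurable_fun_Omega => k E.
  (* This radius bounds every index [k + l + j] with [j] at most the absolute value of [r - l]. *)
  apply: (@measurable_depends_on _ _ (absz k + absz l + absz (r - l))%N).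
  move=> x y xy /=; have -> // : f_infty l r x k = f_infty l r y k.
  apply: val_inj => /=; congr (_ %% _)%N; apply: eq_bigr => -[i ir] _ /=.
  by rewrite xy// /window /=; lia.
have ms : measurable_fun setT (@left_shift m hm).
  by apply: measurable_fun_Omega => k E; exact: measurable_coordinate.
have mi (g : Omega hm -> Omega hm) q :
    measurable_fun setT g -> measurable_fun setT (iter q g).
  move=> mg; elim: q => [|q IH]; first exact: measurable_id.
  exact: measurableT_comp IH.
exact: (measurableT_comp (mi _ p ms) (mi _ n mf)).
Qed.

Lemma measurable_ca_action_preimage m (hm : (0 < m)%N) (l r : int) (p n : nat)
    (A : set (Omega hm)) :
  measurable A -> measurable (ca_action l r p n @^-1` A).
Proof.
rewrite -[_ @^-1` _]setTI.
exact: (@measurable_ca_action _ hm l r p n measurableT A).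
Qed.

Lemma measurable_translate m (hm : (0 < m.+1)%N) (y : Omega hm) :
  measurable_fun setT (translate y).
Proof.
apply: measurable_fun_Omega => k E.
exact: (@measurable_coordinate _ hm k [set a : 'I_m.+1 | E (a + y k)]).
Qed.

(** The preimage of a pattern atom is another pattern atom, and all atoms of one window have the
    same mass. *)
Lemma translate_invariance (R : realType) m (hm : (0 < m.+1)%N)
    (mu : probability (Omega hm) R) (y : Omega hm) (A : set (Omega hm)) :
  uniform_bernoulli mu -> measurable A -> mu (translate y @^-1` A) = mu A.
Proof.
move=> mub; apply: cylinder_invariance => // [|N w w'].
  exact: measurable_translate.
have H (v : {ffun 'I_(N.*2.+1) -> 'I_m.+1}) :
    translate y @^-1` (pattern N @^-1` [set v]) =
    @pattern m.+1 hm N @^-1` [set [ffun i : 'I_(N.*2.+1) => v i - y (i%:Z - N%:Z)]].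
  apply/seteqP; split=> x /= => [<-|/ffunP xv]; apply/ffunP => i.
    by rewrite !ffunE /translate addrK.
  by have := xv i; rewrite !ffunE /translate => ->; rewrite subrK.
by rewrite !H !pattern_atom_prob.
Qed.

(** * Exact independence of distant cylinders *)

Section Independence.
Context (R : realType) (m : nat) (hm : (0 < m.+1)%N).
Variables (mu : probability (Omega hm) R) (l r : int).
Hypothesis mub : uniform_bernoulli mu.

Lemma ca_action_equidistributed (s e : int) (p n N : nat) (W : set int)
    (B : set (Omega hm)) (w w' : {ffun 'I_(N.*2.+1) -> 'I_m.+1}) :
  (s == 1) || (s == -1) -> l <= e <= r ->
  (forall i, l <= i <= r -> i != e -> s * i < s * e) ->
  (forall k, W k -> s * k < s * (p%:Z + n%:Z * e) - N%:Z) ->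
  measurable B -> depends_on W B ->
  mu (B `&` ca_action l r p n @^-1` (pattern N @^-1` [set w])) =
  mu (B `&` ca_action l r p n @^-1` (pattern N @^-1` [set w'])).
Proof.
move=> s1 ler se We mB dB.
have [[x xw] [x' xw']] := (pattern_surj hm w, pattern_surj hm w').
have [y [y0 yv]] := ca_action_interpolation
  (fun k => x' k - x k : 'I_m.+1) s1 ler se We.
(* On the window the image of [y] is [x' - x], so adding [y] turns pattern [w] of the image into
   [w'] while leaving [W] untouched: the right-hand event pulls back exactly to the left-hand
   one. *)
rewrite -[RHS](translate_invariance y mub); last first.
  apply: measurableI => //; apply: measurable_ca_action_preimage.
  exact: measurable_pattern.
congr (mu _); apply/seteqP.
have yW z k : W k -> translate y z k = z k.
  by move=> Wk; rewrite /translate y0// addr0.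
split=> z /= [Bz Tz]; split.
- by apply: dB Bz => k /(yW z) ->.
- rewrite -xw'; apply/patternP => k kN; rewrite ca_action_translate /translate.
  rewrite yv//; move: Tz; rewrite -xw => /patternP -> //.
  by rewrite addrC subrK.
- by apply: dB Bz => k /(yW z) ->.
- rewrite -xw; apply/patternP => k kN.
  move: Tz; rewrite ca_action_translate -xw' => /patternP/(_ k kN).
  by rewrite /translate yv// => /(congr1 (fun a => a - (x' k - x k : 'I_m.+1)));
    rewrite addrK => ->; rewrite opprB addrC subrK.
Qed.

Lemma ca_action_invariance (p n : nat) (A : set (Omega hm)) :
  l <= r -> measurable A -> mu (ca_action l r p n @^-1` A) = mu A.
Proof.
move=> lr; apply: cylinder_invariance => // [|N w w'].
  exact: measurable_ca_action.
rewrite -[X in mu X = _]setTI -[X in _ = mu X]setTI.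
(* With [W] empty and the whole space as [B] the separation condition is vacuous, so all [p] and [n]
   are covered. *)
by apply: (@ca_action_equidistributed 1 r _ _ _ set0) => //; lia.
Qed.

Lemma ca_action_independent (s e : int) (p n N : nat) (A B : set (Omega hm)) :
  (s == 1) || (s == -1) -> l <= e <= r ->
  (forall i, l <= i <= r -> i != e -> s * i < s * e) ->
  N.*2%:Z < s * (p%:Z + n%:Z * e) ->
  depends_on (window N) A -> depends_on (window N) B ->
  fine (mu (B `&` ca_action l r p n @^-1` A)) = fine (mu A) * fine (mu B).
Proof.
move=> s1 ler se NT dA dB.
have mB := measurable_depends_on dB.
(* The spikes start at [s * (p + n e) - N] in direction [s]; the threshold [2N] puts this beyond
   [N], the far end of the window. *)
have We k : window N k -> s * k < s * (p%:Z + n%:Z * e) - N%:Z.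
  by rewrite /window /=; case/orP: s1 NT => /eqP ->; lia.
pose x0 : Omega hm := fun=> 0 : 'I_m.+1.
pose F := {ffun 'I_(N.*2.+1) -> 'I_m.+1}.
have n0 : #|F|%:R != 0 :> R.
  by rewrite pnatr_eq0 -lt0n; apply/card_gt0P; exists (pattern N x0).
have mp := @measurable_pattern _ hm N.
have mTp w : measurable ((@pattern _ hm N \o ca_action l r p n) @^-1` [set w]).
  exact: measurable_ca_action_preimage (mp w).
(* Both [e1], inside [B] for patterns of the image, and [e2], in the whole space for patterns of the
   point, produce the same proportion of patterns, namely that of [A]. *)
have e1 := @equidistributed_fibers _ _ _ mu _ _ mTp B
  (fine (mu (B `&` (@pattern _ hm N \o ca_action l r p n) @^-1`
     [set pattern N x0]))) (pattern N @` A) mB.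
have e2 := @equidistributed_fibers _ _ _ mu _ _ mp setT
  ((m.+1%:R^-1 : R) ^+ N.*2.+1) (pattern N @` A) measurableT.
rewrite !setTI probability_setT mulr1 in e2.
rewrite [in LHS](depends_onE dA) [in RHS](depends_onE dA).
apply: (mulIf n0); rewrite [RHS]mulrAC e2; last first.
  by move=> w; rewrite setTI pattern_atom_prob.
apply: e1 => w; rewrite fineK.
  exact: (ca_action_equidistributed _ _ s1 ler se We).
by apply: fine_probability_fin_num; exact: measurableI.
Qed.

End Independence.

(** * Asymptotic independence of measurable sets *)

Lemma ca_action_decorrelation (R : realType) m (hm : (0 < m.+1)%N)
    (mu : probability (Omega hm) R) (l r : int) (A B : set (Omega hm)) (eps : R) :
  l <= r -> uniform_bernoulli mu -> measurable A -> measurable B -> 0 < eps ->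
  exists K : nat, forall p n : nat,
    (K%:Z < p%:Z + n%:Z * r) || (p%:Z + n%:Z * l < - K%:Z) ->
    `|fine (mu (B `&` ca_action l r p n @^-1` A)) - fine (mu A) * fine (mu B)|
      <= eps.
Proof.
(* There are four errors: [A] and [B] are each replaced once in the joint probability and once in
   the product. *)
move=> lr mub mA mB e0; have e4 : 0 < eps / 4 by rewrite divr_gt0.
have approx := algebra_approximation mu (@cylinder_generates _ hm)
  (cylinder_setT hm) (@cylinderI _ hm) (@cylinderC _ hm).
have [A' [M dA'] AA'] := approx _ mA _ e4.
have [B' [M' dB'] BB'] := approx _ mB _ e4.
have {}dA' : depends_on (window (maxn M M')) A'.
  by apply: depends_onS dA'; apply: windowS; exact: leq_maxl.
have {}dB' : depends_on (window (maxn M M')) B'.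
  by apply: depends_onS dB'; apply: windowS; exact: leq_maxr.
move: (maxn M M') dA' dB' => N dA' dB'.
have mA' := measurable_depends_on dA'; have mB' := measurable_depends_on dB'.
exists N.*2 => p n good.
have indep : fine (mu (B' `&` ca_action l r p n @^-1` A')) =
    fine (mu A') * fine (mu B').
  case/orP: good => good.
    (* A far right end of the dependence interval is exploited with [e = r], a far left end with
       [e = l] and reversed direction. *)
    by apply: (@ca_action_independent _ _ _ _ _ _ _ 1 r _ _ N) => //; lia.
  by apply: (@ca_action_independent _ _ _ _ _ _ _ (- 1) l _ _ N) => //; lia.
have d1 : `|fine (mu (B `&` ca_action l r p n @^-1` A)) -
    fine (mu (B' `&` ca_action l r p n @^-1` A'))| <= eps / 4 + eps / 4.
  have mI (E E' : set (Omega hm)) : measurable E -> measurable E' ->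
      measurable (E' `&` ca_action l r p n @^-1` E).
    move=> mE mE'; apply: measurableI => //.
    exact: measurable_ca_action_preimage.
  apply: (le_trans (fine_probability_dist _ (mI _ _ mA mB) (mI _ _ mA' mB'))).
  apply: (@le_trans _ _ (fine (mu (ca_action l r p n @^-1` (A `+` A'))) +
      fine (mu (B `+` B')))).
    apply: fine_probability_subU.
    - by apply: measurable_setY; exact: mI.
    - by apply: measurable_ca_action_preimage; exact: measurable_setY.
    - exact: measurable_setY.
    - move=> x; rewrite /setY /setU /setD /setI /=.
      have [] := pselect (B x); have [] := pselect (B' x);
      have [] := pselect (A (ca_action l r p n x));
      have [] := pselect (A' (ca_action l r p n x)); tauto.
  rewrite ca_action_invariance//; last exact: measurable_setY.
  by apply: lerD; exact: ltW.
have d2 : `|fine (mu A) * fine (mu B) - fine (mu A') * fine (mu B')|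
    <= eps / 4 + eps / 4.
  have -> : fine (mu A) * fine (mu B) - fine (mu A') * fine (mu B') =
      (fine (mu A) - fine (mu A')) * fine (mu B) +
      fine (mu A') * (fine (mu B) - fine (mu B')) by ring.
  apply: (le_trans (ler_normD _ _)); rewrite !normrM.
  apply: lerD.
    rewrite -[leRHS]mulr1; apply: ler_pM => //.
      by apply/ltW/(le_lt_trans _ AA')/fine_probability_dist.
    by rewrite ger0_norm ?fine_probability_ge0// fine_probability_le1.
  rewrite -[leRHS]mul1r; apply: ler_pM => //.
    by rewrite ger0_norm ?fine_probability_ge0// fine_probability_le1.
  by apply/ltW/(le_lt_trans _ BB')/fine_probability_dist.
rewrite indep in d1; move: d1 d2; rewrite !ler_norml => /andP[? ?] /andP[? ?].
by apply/andP; split; lra.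
Qed.

(** * Limits and averages over rectangles *)

Lemma near_filter_prod_oo (N : nat) (Q : set (nat * nat)) :
  (forall p n, (N <= p)%N -> (N <= n)%N -> Q (p, n)) -> filter_prod \oo \oo Q.
Proof.
move=> NQ; exists ([set p | (N <= p)%N], [set n | (N <= n)%N]).
  by split; exists N.
by move=> [p n] [/= Np Nn]; exact: NQ.
Qed.

Lemma card_translated_interval (p K : nat) (c : int) :
  (\sum_(i < p) (`|i%:Z + c|%R <= K%:Z)%R <= K.*2.+1)%N.
Proof.
pose A := [pred i : 'I_p | (`|i%:Z + c| <= K%:Z)%R].
have -> : (\sum_(i < p) (`|i%:Z + c|%R <= K%:Z)%R = #|A|)%N.
  rewrite -sum1_card [RHS]big_mkcond; apply: eq_bigr => i _.
  by rewrite inE; case: ifP.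
(* On [A] the number [i + c + K] lies between 0 and [2K], so [inord] never takes its default value
   there. *)
pose f (i : 'I_p) : 'I_(K.*2.+1) := inord (absz (i%:Z + c + K%:Z)).
have fA : {in A &, injective f}.
  move=> i j; rewrite !inE => iA jA /(congr1 val) /=.
  by rewrite !inordK; [move=> ij; apply: val_inj => /=; lia|lia|lia].
by rewrite -(card_in_image fA) -[leqRHS]card_ord max_card.
Qed.

Section Averages.
Context (R : realType).
Implicit Types (a : nat -> nat -> R).

Let average a (pn : nat * nat) : R :=
  (pn.1%:R * pn.2%:R)^-1 * \sum_(i < pn.1) \sum_(j < pn.2) a i j.

(* For each [j] at most [2 K + 1] indices [i] satisfy [|i + j * c| <= K]. *)
Lemma average_cvg0 a (c : int) :
  (forall i j, 0 <= a i j <= 1) ->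
  (forall eps : R, 0 < eps -> exists K : nat, forall i j : nat,
    K%:Z < `|i%:Z + j%:Z * c| -> a i j <= eps) ->
  average a @ filter_prod \oo \oo --> (0 : R).
Proof.
move=> a01 asmall; apply/cvgrPdist_le => /= e e0.
have e2 : 0 < e / 2 by rewrite divr_gt0.
have [K aK] := asmall _ e2.
(* For [p >= N] the at most [2K + 1] bad indices of each column weigh at most [e / 2] after division
   by [p]. *)
pose N := (Num.truncn ((K.*2.+1)%:R / (e / 2))).+1.
have NK : (K.*2.+1)%:R <= e / 2 * N%:R.
  by rewrite mulrC -ler_pdivrMr// ltW// truncnS_gt.
apply: (@near_filter_prod_oo N) => p n Np Nn.
have p0 : 0 < p%:R :> R by rewrite ltr0n (leq_trans _ Np).
have n0 : 0 < n%:R :> R by rewrite ltr0n (leq_trans _ Nn).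
have a0 : 0 <= \sum_(i < p) \sum_(j < n) a i j.
  by apply: sumr_ge0 => i _; apply: sumr_ge0 => j _; case/andP: (a01 i j).
rewrite sub0r normrN /average /= ger0_norm; last first.
  by rewrite mulr_ge0// invr_ge0 mulr_ge0// ltW.
rewrite ler_pdivrMl ?mulr_gt0//.
pose bad (i j : nat) : bool := `|i%:Z + j%:Z * c| <= K%:Z.
have ab i j : a i j <= e / 2 + (bad i j)%:R.
  rewrite /bad; case: (leP `|i%:Z + j%:Z * c| K%:Z) => h; last first.
    by rewrite addr0; exact: aK.
  by case/andP: (a01 i j) => _ a1; apply: (le_trans a1); rewrite lerDr ltW.
(* The sums are exchanged because the bad [i] are counted for fixed [j]. *)
apply: (@le_trans _ _ (\sum_(j < n) \sum_(i < p) (e / 2 + (bad i j)%:R))).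
  by rewrite exchange_big; apply: ler_sum => j _; apply: ler_sum => i _; exact: ab.
apply: (@le_trans _ _ (\sum_(j < n) (p%:R * (e / 2) + (K.*2.+1)%:R))).
  apply: ler_sum => j _; rewrite big_split /= sumr_const card_ord mulr_natl.
  by rewrite lerD2l -natr_sum ler_nat card_translated_interval.
rewrite sumr_const card_ord -[leLHS]mulr_natl.
have : e / 2 * N%:R <= e / 2 * p%:R by rewrite ler_pM2l// ler_nat.
move=> NP; have KP := le_trans NK NP.
have -> : p%:R * n%:R * e = n%:R * (p%:R * (e / 2) + e / 2 * p%:R) by field.
by rewrite ler_pM2l// lerD2l.
Qed.

Lemma average_cvg a (c : R) :
  average (fun i j => `|a i j - c|) @ filter_prod \oo \oo --> (0 : R) ->
  average a @ filter_prod \oo \oo --> c.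
Proof.
move=> /cvgrPdist_le ac; apply/cvgrPdist_le => /= e /ac.
(* As the inverse of 0 is 0, the constant [c] equals its own average only when both sides of the
   rectangle are positive. *)
have pos : filter_prod \oo \oo [set pn : nat * nat | (0 < pn.1)%N && (0 < pn.2)%N].
  by apply: (@near_filter_prod_oo 1) => p n /= -> ->.
move=> near_e; apply: filterS2 pos near_e => -[p n] /andP[/= p0 n0].
apply: le_trans; rewrite sub0r normrN /average /=.
have pn0 : 0 < (p%:R * n%:R : R) by rewrite mulr_gt0// ltr0n.
have cE : c = (p%:R * n%:R)^-1 * \sum_(i < p) \sum_(j < n) c.
  rewrite !sumr_const !card_ord -mulrnA mulnC -(mulr_natl c) natrM.
  by rewrite mulKf// gt_eqF.
rewrite {1}cE -mulrBr !normrM ler_pM2l ?normr_gt0 ?invr_eq0 ?gt_eqF//.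
rewrite -sumrB [leRHS]ger0_norm; last first.
  by apply: sumr_ge0 => i _; exact: sumr_ge0.
apply: (le_trans (ler_norm_sum _ _ _)); apply: ler_sum => i _.
rewrite -sumrB; apply: (le_trans (ler_norm_sum _ _ _)); apply: ler_sum => j _.
by rewrite distrC.
Qed.

End Averages.

(** * The three mixing properties *)

Theorem theorem2 (R : realType) (m : nat) (hm : (0 < m)%N) (l r : int)
    (mu : probability (Omega hm) R) :
  l <= r -> uniform_bernoulli mu ->
  [/\ ergodic_action mu (ca_action l r),
      ~ [/\ (1 < m)%N, l = r & l < 0] ->
        strongly_mixing_action mu (ca_action l r)
    & weakly_mixing_action mu (ca_action l r)].
Proof.
case: m hm mu => // m hm mu lr mub.
have weak : weakly_mixing_action mu (ca_action l r).
  move=> A B mA mB.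
  apply: (@average_cvg0 _ (fun i j => `|fine (mu (B `&` ca_action l r i j @^-1` A))
    - fine (mu A) * fine (mu B)|) l) => [i j|e e0].
    have mI : measurable (B `&` ca_action l r i j @^-1` A).
      apply: measurableI => //.
      exact: measurable_ca_action_preimage.
    rewrite normr_ge0 /= ler_norml.
    have := fine_probability_ge0 mu A; have := fine_probability_ge0 mu B.
    have := fine_probability_le1 mu mA; have := fine_probability_le1 mu mB.
    have := fine_probability_le1 mu mI.
    have := fine_probability_ge0 mu (B `&` ca_action l r i j @^-1` A).
    by move=> *; apply/andP; split; nra.
  have [K decor] := ca_action_decorrelation lr mub mA mB e0.
  (* If [i + j l > K], then also [i + j r > K] because [l <= r]. *)
  exists K => i j ij; apply: decor; nia.
split=> // [A B mA mB|lr0 A B mA mB].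
  apply: (@average_cvg _
    (fun i j => fine (mu (B `&` ca_action l r i j @^-1` A)))).
  exact: weak.
apply/cvgrPdist_le => /= e e0.
have [K decor] := ca_action_decorrelation lr mub mA mB e0.
(* A one-letter alphabet gives a one-point space, where every event is trivial; there [l = r < 0] is
   still allowed. *)
have [m0|m1] := leqP m.+1 1.
  have all_eq (x y : Omega hm) : x = y.
    apply/funext => k; apply: val_inj => /=.
    by have := ltn_ord (x k); have := ltn_ord (y k); lia.
  apply: (@near_filter_prod_oo 0) => p n _ _ /=.
  have [Ae|] := eqVneq A set0.
    by rewrite Ae preimage_set0 set0I measure0 mul0r subrr normr0 ltW.
  move=> /set0P[a Aa]; have -> : A = setT.
    by apply/seteqP; split=> // x _; rewrite (all_eq x a).
  by rewrite preimage_setT setTI probability_setT mul1r subrr normr0 ltW.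
(* If [l < r] and both alternatives of [decor] fail, then [n (r - l) <= 2K], contradicting [n > 2K].
   If [l = r >= 0], then [p > K] is enough. *)
apply: (@near_filter_prod_oo K.*2.+1) => p n Kp Kn /=.
rewrite distrC setIC; apply: decor.
have [lr'|rl] := ltP l r; first by nia.
have lr_eq : l = r by lia.
have l0 : 0 <= l by rewrite leNgt; apply/negP => l0; apply: lr0.
by rewrite -lr_eq; nia.
Qed.
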